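(* Let $(\mathscr{B},|\cdot|)$ be an ultrametric Banach algebra with a continuous derivation $d:\mathscr{B}\to\mathscr{B}$ of operator norm $|d|$, and let $(M,\nabla)$ be a differential module over $(\mathscr{B},d)$ of rank $n$ with basis $\mathbf{e}=\{e_0,\ldots,e_{n-1}\}$. Assume that $(n-1)!$ is invertible in $\mathscr{B}$ and that there is an element $t\in\mathscr{B}$ with $d(t)=1$. Let $G_1\in M_n(\mathscr{B})$ be the matrix of $\nabla$ in the basis $\mathbf{e}$, and let $|G_1|^{(|d|)}$ be its $\rho$-sup-norm for $\rho=|d|$. Assume that $$|G_1|^{(|d|)}\;<\;\frac{|(n-1)!|^2\,|d|}{(|d||t|)^{2n-2}}.$$ Then $(M,\nabla)$ is cyclic, and the Katz vector $c_0(\mathbf{e},t)$ is a cyclic vector for $M$.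
   Context: An ultrametric norm on a commutative unital ring $\mathscr{B}$ is a map $|\cdot|:\mathscr{B}\to\mathbb{R}_{\ge 0}$ with $|0|=0$, $|1|=1$, $|a+b|\le\max(|a|,|b|)$, $|ab|\le|a||b|$ for all $a,b\in\mathscr{B}$, and moreover $|na|=|n||a|$ for all $n\in\mathbb{Z}$, $a\in\mathscr{B}$ (where $|n|:=|n\cdot 1|$). An ultrametric Banach algebra is such a ring that is complete and separated ($|a|=0$ implies $a=0$) for $|\cdot|$. The norm is not assumed multiplicative. A derivation $d$ of $\mathscr{B}$ is a $\mathbb{Z}$-linear map with $d(ab)=ad(b)+d(a)b$. Its operator norm is $|d|:=\sup_{b\neq0}|d(b)|/|b|$, which is a finite real number. A differential module $(M,\nabla)$ of rank $n$ over $(\mathscr{B},d)$ is a free $\mathscr{B}$-module $M$ of finite rank $n$ with a $\mathbb{Z}$-linear map $\nabla:M\to M$ such that $\nabla(bm)=d(b)m+b\nabla(m)$ for $b\in\mathscr{B}$, $m\in M$. A cyclic vector is an element $m\in M$ such that $\{m,\nabla(m),\ldots,\nabla^{n-1}(m)\}$ is a basis of $M$ over $\mathscr{B}$; $M$ is cyclic if it has a cyclic vector. The matrix $G_1=(g_{i,j})_{i,j=0,\ldots,n-1}$ is defined by $\nabla(e_i)=\sum_{j=0}^{n-1}g_{i,j}e_j$. For $\rho>0$ the $\rho$-sup-norm of a matrix is $|(a_{i,j})|^{(\rho)}:=\sup_{i,j}|a_{i,j}|\rho^{j-i}$; thus $|(a_{i,j})|^{(|d|)}=\sup_{i,j}|a_{i,j}||d|^{j-i}$.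 The Katz vector is $$c_0(\mathbf{e},t)=\sum_{j=0}^{n-1}\frac{t^j}{j!}\sum_{k=0}^{j}(-1)^k\binom{j}{k}\nabla^k(e_{j-k}).$$ *)

(* Defs.v *)
From HB Require Import structures.
From mathcomp Require Import all_boot all_order all_algebra.
From mathcomp Require Import boolp classical_sets reals.

Set Implicit Arguments.
Unset Strict Implicit.
Unset Printing Implicit Defensive.

Import Order.TTheory GRing.Theory Num.Theory.
Local Open Scope ring_scope.
Local Open Scope classical_set_scope.

Section Banach.
Context {R : realType} {B : comUnitRingType}.
Implicit Types (nrm : B -> R) (d : B -> B).

(* The norm is only submultiplicative. *)
Record ultrametric_norm nrm : Prop := {
  unorm_ge0 : forall a, 0 <= nrm a;
  unorm0 : nrm 0 = 0;
  unorm1 : nrm 1 = 1;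
  unormD : forall a b, nrm (a + b) <= Num.max (nrm a) (nrm b);
  unormM : forall a b, nrm (a * b) <= nrm a * nrm b;
  unormMz : forall (m : int) a, nrm (a *~ m) = nrm m%:~R * nrm a
}.

Definition norm_cauchy nrm (u : nat -> B) : Prop :=
  forall eps : R, 0 < eps -> exists N : nat,
    forall p q : nat, (N <= p)%N -> (N <= q)%N -> nrm (u p - u q) < eps.

Definition norm_cvg nrm (u : nat -> B) (l : B) : Prop :=
  forall eps : R, 0 < eps -> exists N : nat,
    forall p : nat, (N <= p)%N -> nrm (u p - l) < eps.

Record ultrametric_banach nrm : Prop := {
  ubanach_norm : ultrametric_norm nrm;
  ubanach_separated : forall a, nrm a = 0 -> a = 0;
  ubanach_complete : forall u, norm_cauchy nrm u -> exists l, norm_cvg nrm u l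
}.

Definition norm_continuous nrm d : Prop :=
  forall a (eps : R), 0 < eps -> exists2 delta : R, 0 < delta &
    forall b, nrm (b - a) < delta -> nrm (d b - d a) < eps.

Definition opnorm_ratios nrm d : set R :=
  [set nrm (d b) / nrm b | b in [set b | b != 0]].

(* Meaningful when the set of ratios is bounded above, since [sup] of an
   unbounded set is 0. *)
Definition opnorm nrm d : R := sup (opnorm_ratios nrm d).

(* Additivity is carried by the type of [d]. *)
Definition derivation (d : {additive B -> B}) : Prop :=
  forall a b, d (a * b) = a * d b + d a * b.

(* The operator norm is required to be finite, which continuity alone does not
   give in the absence of a nontrivially valued base field. *)
Definition continuous_derivation nrm (d : {additive B -> B}) : Prop :=
  [/\ derivation d, norm_continuous nrm d & has_ubound (opnorm_ratios nrm d)].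

(* The entries are nonnegative, so the default value 0 of the maximum is
   harmless for n > 0. *)
Definition rho_norm nrm (rho : R) n (A : 'M[B]_n) : R :=
  \big[Num.max/0]_(i < n) \big[Num.max/0]_(j < n)
    (nrm (A i j) * rho ^ (j%:Z - i%:Z)).

End Banach.

Section DifferentialModule.
Context {B : comUnitRingType} {M : lmodType B}.
Implicit Types (d : {additive B -> B}) (nabla : {additive M -> M}).

Definition is_basis n (e : 'I_n -> M) : Prop :=
  forall m : M, exists! c : 'rV[B]_n, m = \sum_(i < n) c 0 i *: e i.

Definition differential_module n d nabla : Prop :=
  (exists e : 'I_n -> M, is_basis e) /\
  (forall (b : B) (m : M), nabla (b *: m) = d b *: m + b *: nabla m).

Definition cyclic_vector n nabla (m : M) : Prop :=
  is_basis (fun i : 'I_n => iter i nabla m).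

Definition is_cyclic n nabla : Prop := exists m : M, cyclic_vector n nabla m.

Definition connection_matrix n nabla (e : 'I_n -> M) (G : 'M[B]_n) : Prop :=
  forall i, nabla (e i) = \sum_(j < n) G i j *: e j.

Definition ord_subn n (j : 'I_n) (k : nat) : 'I_n :=
  Ordinal (leq_ltn_trans (leq_subr k j) (ltn_ord j)).

Definition katz_vector n nabla (e : 'I_n -> M) (t : B) : M :=
  \sum_(j < n) (t ^+ j / j`!%:R) *:
    \sum_(k < j.+1) ((-1) ^+ k * 'C(j, k)%:R) *: iter k nabla (e (ord_subn j k)).

End DifferentialModule.

(* Main.v *)
(** Give [M] the sup norm in which [e j] has norm [|d|^j]. The smallness of [G1]
    makes [nabla] an operator of norm at most [|d|] for it, while [nabla (e j)]
    is small. Hence [nabla^i c_0] differs from its value for a trivial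
    connection, [\sum_(j >= i) t^(j-i)/(j-i)! e_j], by a small error [E_i]. The
    matrix [T] of these main terms is the exponential of [t] times the nilpotent
    shift, so its inverse is obtained by replacing [t] with [-t], and
    [T + E = T (1 + T^-1 E)] where [T^-1 E] has [rho]-sup-norm [< 1] for
    [rho = |d|]. Finally
    [det (1 + T^-1 E)] is at distance [< 1] from [1], because the weights
    [rho^(s(i)-i)] multiply to [1] along every permutation [s]; it is a unit by
    the geometric series. *)
Require Import Defs.
From mathcomp Require Import all_boot all_order all_fingroup all_algebra.
From mathcomp Require Import reals ring.

Set Implicit Arguments.
Unset Strict Implicit.
Unset Printing Implicit Defensive.

Import Order.TTheory GRing.Theory Num.Theory.
Local Open Scope ring_scope.

(** * Ultrametric norms: integer scalars, weighted products, determinants near 1 *)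

Section UltrametricNorm.
Context {R : realType} {B : comUnitRingType} {nrm : B -> R}.
Hypothesis hnrm : ultrametric_norm nrm.

Lemma unorm_natM m a : nrm (a *+ m) = nrm m%:R * nrm a.
Proof. by have := unormMz hnrm m a; rewrite !pmulrn. Qed.

(** Homogeneity over the integers gives [|-1|^2 = 1], hence [|-1| = 1]; submultiplicativity would
    only give [1 <= |-1|^2]. *)
Lemma unormN a : nrm (- a) = nrm a.
Proof.
have N1sq : nrm (-1) * nrm (-1) = 1.
  by have := unormMz hnrm (-1) (-1); rewrite mulrN1z opprK (unorm1 hnrm).
have N1 : nrm (-1) = 1.
  by apply/eqP; rewrite -(@pexpr_eq1 _ _ 2) ?(unorm_ge0 hnrm)// expr2 N1sq.
by have := unormMz hnrm (-1) a; rewrite !mulrN1z N1 mul1r.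
Qed.

Lemma unorm_nat_le1 m : nrm m%:R <= 1.
Proof.
elim: m => [|m IH]; first by rewrite (unorm0 hnrm).
by rewrite -natr1 (le_trans (unormD hnrm _ _))// ge_max IH (unorm1 hnrm) /=.
Qed.

Lemma unorm_sum_le (I : Type) (r : seq I) (P : pred I) (F : I -> B) (x : R) :
  0 <= x -> (forall i, P i -> nrm (F i) <= x) ->
  nrm (\sum_(i <- r | P i) F i) <= x.
Proof.
move=> x0 hF; apply: (big_ind (fun a => nrm a <= x)) => //.
- by rewrite (unorm0 hnrm).
- by move=> a b ha hb; rewrite (le_trans (unormD hnrm _ _))// ge_max ha hb.
Qed.

Lemma unorm_sum_lt (I : Type) (r : seq I) (P : pred I) (F : I -> B) (x : R) :
  0 < x -> (forall i, P i -> nrm (F i) < x) ->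
  nrm (\sum_(i <- r | P i) F i) < x.
Proof.
move=> x0 hF; apply: (big_ind (fun a => nrm a < x)) => //.
- by rewrite (unorm0 hnrm).
- by move=> a b ha hb; rewrite (le_lt_trans (unormD hnrm _ _))// gt_max ha hb.
Qed.

Lemma unormX a k : nrm (a ^+ k) <= nrm a ^+ k.
Proof.
elim: k => [|k IH]; first by rewrite !expr0 (unorm1 hnrm).
by rewrite !exprS (le_trans (unormM hnrm _ _))// ler_wpM2l// (unorm_ge0 hnrm).
Qed.

Lemma unorm_sign_mul (b : bool) a : nrm ((-1) ^+ b * a) = nrm a.
Proof. by case: b; rewrite ?expr0 ?expr1 ?mul1r ?mulN1r ?unormN. Qed.

Lemma unorm_unit_nat_gt0 m :
  (m%:R : B) \is a GRing.unit -> 0 < nrm m%:R.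
Proof.
move=> um; rewrite lt_def (unorm_ge0 hnrm) andbT.
apply/eqP => m0; have := unorm_natM m m%:R^-1.
rewrite m0 mul0r -[_ *+ m]mulr_natl divrr// (unorm1 hnrm) => /eqP.
by rewrite oner_eq0.
Qed.

(** An equality although the norm is only submultiplicative: homogeneity makes integers
    multiplicative, so multiplying [a / m] by [m] recovers [|a|] exactly. *)
Lemma unorm_div_nat a m :
  (m%:R : B) \is a GRing.unit -> nrm (a / m%:R) = nrm a / nrm m%:R.
Proof.
move=> um; have m0 := unorm_unit_nat_gt0 um.
apply: (canRL (mulfK (lt0r_neq0 m0))).
by rewrite mulrC -unorm_natM -[_ *+ m]mulr_natr mulrVK.
Qed.

(** [m!] is an integer multiple of [j!], and integers have norm at most 1. *)
Lemma unorm_fact_le j m : (j <= m)%N -> nrm m`!%:R <= nrm j`!%:R.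
Proof.
move=> jm; rewrite -(ffact_fact (leq_subr j m)) subKn// natrM mulr_natl.
by rewrite unorm_natM ler_piMl ?unorm_nat_le1 ?(unorm_ge0 hnrm).
Qed.

(** The factors [a i] are exchanged for [b i] one at a time. Each weight [r i] stays with its
    factor, since [a i] and [b i] may have norm above 1. *)
Lemma unorm_prod_sub (I : Type) (s : seq I) (a b : I -> B) (r : I -> R) :
  (forall i, 0 <= r i) ->
  (forall i, nrm (a i) * r i <= 1) -> (forall i, nrm (b i) * r i <= 1) ->
  (forall i, nrm (a i - b i) * r i < 1) ->
  nrm (\prod_(i <- s) a i - \prod_(i <- s) b i) * \prod_(i <- s) r i < 1.
Proof.
move=> r0 ha hb hab.
have mul_le x y (p q : R) : 0 <= p -> 0 <= q ->
    nrm (x * y) * (p * q) <= nrm x * p * (nrm y * q).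
  move=> p0 q0; rewrite [leRHS]mulrACA ler_wpM2r ?mulr_ge0//.
  exact: unormM hnrm _ _.
have n0 x (p : R) : 0 <= p -> 0 <= nrm x * p.
  by move=> p0; rewrite mulr_ge0 ?(unorm_ge0 hnrm).
have prod_r0 (u : seq I) : 0 <= \prod_(i <- u) r i by rewrite prodr_ge0.
have hpa (u : seq I) : nrm (\prod_(i <- u) a i) * \prod_(i <- u) r i <= 1.
  elim: u => [|i u IH]; first by rewrite !big_nil (unorm1 hnrm) mulr1.
  by rewrite !big_cons (le_trans (mul_le _ _ _ _ _ _))// mulr_ile1 ?n0.
elim: s => [|i s IH]; first by rewrite !big_nil subrr (unorm0 hnrm) mul0r ltr01.
rewrite !big_cons.
set pa := \prod_(j <- s) a j in IH *; set pb := \prod_(j <- s) b j in IH *.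
have -> : a i * pa - b i * pb = (a i - b i) * pa + b i * (pa - pb).
  by rewrite mulrBl mulrBr addrA subrK.
have q0 : 0 <= r i * \prod_(j <- s) r j by rewrite mulr_ge0.
apply: le_lt_trans (ler_wpM2r q0 (unormD hnrm _ _)) _.
rewrite maxr_pMl// gt_max; apply/andP; split.
- apply: le_lt_trans (mul_le _ _ _ _ _ _) _ => //.
  by apply: le_lt_trans (hab i); rewrite ler_piMr ?n0 ?hpa.
- apply: le_lt_trans (mul_le _ _ _ _ _ _) _ => //.
  by apply: le_lt_trans IH; rewrite ler_piMl ?n0 ?hb.
Qed.

Lemma prod_perm_ratio n (w : 'I_n -> R) (s : 'S_n) :
  (forall i, 0 < w i) -> \prod_i (w (s i) / w i) = 1.
Proof.
move=> w0; rewrite big_split /= prodfV.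
rewrite [X in _ / X](reindex_inj (@perm_inj _ s)) /=.
by rewrite mulfV// lt0r_neq0// prodr_gt0.
Qed.

(** The Leibniz expansions of [A] and of the identity are compared permutation by permutation;
    inserting the ratios [w (s i) / w i], of product 1, reduces each comparison to
    [unorm_prod_sub]. *)
Lemma unorm_det_sub1 n (w : 'I_n -> R) (A : 'M[B]_n) :
  (forall i, 0 < w i) ->
  (forall i j, nrm ((A - 1%:M) i j) * w j < w i) -> nrm (\det A - 1) < 1.
Proof.
move=> w0 hA; rewrite -[X in _ - X](det1 B n) -sumrB.
apply: unorm_sum_lt => // s _.
rewrite -mulrBr unorm_sign_mul -[X in X < _]mulr1.
rewrite -[X in _ * X](prod_perm_ratio s w0).
have r0 i : 0 < w (s i) / w i by rewrite divr_gt0.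
have h1 i : nrm ((1%:M : 'M[B]_n) i (s i)) * (w (s i) / w i) <= 1.
  rewrite mxE; have [<-|_] := eqVneq; last by rewrite (unorm0 hnrm) mul0r.
  by rewrite (unorm1 hnrm) mul1r divff// lt0r_neq0.
have hd i : nrm (A i (s i) - (1%:M : 'M[B]_n) i (s i)) * (w (s i) / w i) < 1.
  by rewrite mulrA ltr_pdivrMr// mul1r; have := hA i (s i); rewrite !mxE.
apply: unorm_prod_sub => // i; first exact: ltW.
rewrite -[A i _](subrK ((1%:M : 'M[B]_n) i (s i))).
apply: le_trans (ler_wpM2r (ltW (r0 i)) (unormD hnrm _ _)) _.
by rewrite maxr_pMl ?ge_max ?h1 ?ltW.
Qed.

End UltrametricNorm.

(** * Geometric series, units near 1 and the operator norm *)

Lemma expr_lt_eps (R : realType) (q eps : R) :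
  0 <= q < 1 -> 0 < eps -> exists N, forall k, (N <= k)%N -> q ^+ k < eps.
Proof.
move=> /andP[q0 q1] eps0.
have [->|qn0] := eqVneq q 0.
  (* The bound cannot be 0 here, because [0 ^+ 0 = 1]. *)
  by exists 1%N => -[|k]// _; rewrite expr0n.
have {}q0 : 0 < q by rewrite lt_def qn0.
pose h := q^-1 - 1.
have h0 : 0 < h by rewrite subr_gt0 invf_gt1.
(* Bernoulli's inequality for [q^-1 = 1 + h]; the Archimedean property then makes [q^-k] exceed
   [eps^-1]. *)
have bern m : h * m%:R <= (q^-1) ^+ m - 1.
  elim: m => [|m IH]; first by rewrite mulr0 expr0 subrr.
  have -> : q^-1 ^+ m.+1 - 1 = q^-1 ^+ m - 1 + h * q^-1 ^+ m.
    by rewrite mulrBl mul1r exprS [RHS]addrC addrA subrK.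
  rewrite -natr1 mulrDr mulr1 lerD// ler_peMr ?(ltW h0)//.
  by rewrite exprn_ege1// ltW// invf_gt1.
exists (Num.bound (eps^-1 / h)) => k hk.
rewrite -[ltRHS]invrK -[ltLHS]invrK ltf_pV2 ?posrE ?invr_gt0 ?exprn_gt0//.
rewrite -exprVn.
have : eps^-1 / h < k%:R.
  apply: lt_le_trans (archi_boundP _) _; last by rewrite ler_nat.
  by rewrite divr_ge0 ?invr_ge0 ?ltW.
rewrite ltr_pdivrMr// mulrC => /lt_le_trans; apply.
by apply: le_trans (bern k) _; rewrite gerBl.
Qed.

Section UltrametricBanach.
Context {R : realType} {B : comUnitRingType} {nrm : B -> R}.
Hypothesis hB : ultrametric_banach nrm.
Let hnrm : ultrametric_norm nrm := ubanach_norm hB.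

Lemma ubanach_gt0 a : a != 0 -> 0 < nrm a.
Proof.
move=> a0; rewrite lt_def (unorm_ge0 hnrm) andbT.
by apply: contra a0 => /eqP /(ubanach_separated hB) ->.
Qed.

Lemma ubanach_unit a : nrm (a - 1) < 1 -> a \is a GRing.unit.
Proof.
set x := 1 - a; rewrite -(unormN hnrm) opprB -/x => x1.
have x01 : 0 <= nrm x < 1 by rewrite (unorm_ge0 hnrm).
pose u k := \sum_(i < k) x ^+ i.
have a_u k : a * u k = 1 - x ^+ k.
  rewrite -[X in X - _](expr1n _ k) subrXX mulrC [RHS]mulrC.
  congr (_ * _); last by rewrite /x subKr.
  by apply: eq_bigr => i _; rewrite expr1n mul1r.
have [l hl] : exists l, norm_cvg nrm u l.
  apply: (ubanach_complete hB) => eps eps0.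
  have [N hN] := expr_lt_eps x01 eps0; exists N.
  have main p q : (N <= p)%N -> (p <= q)%N -> nrm (u q - u p) < eps.
    move=> Np pq; rewrite /u -!(big_mkord xpredT (fun i => x ^+ i)).
    rewrite [X in X - _](big_cat_nat (n := p))//=.
    rewrite [X in nrm X]addrC addKr big_nat_cond.
    apply: (unorm_sum_lt hnrm) => // i /andP[/andP[pi _] _].
    by rewrite (le_lt_trans (unormX hnrm _ _))// hN// (leq_trans Np).
  move=> p q Np Nq; case: (leqP p q) => [|/ltnW] pq; last exact: main.
  by rewrite -(unormN hnrm) opprB main.
have al : a * l = 1; last first.
  by apply/unitrP; exists l; rewrite mulrC.
(* Otherwise [|a l - 1|] is itself an admissible precision: for large [k], both [a (u k - l)] and
   [x ^+ k] fall below it, and so does [a l - 1], a contradiction. *)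
apply/eqP; rewrite -subr_eq0; apply: contraT => /ubanach_gt0 al1.
have a_gt0 : 0 < nrm a.
  apply: ubanach_gt0; apply: contraTneq x1.
  by rewrite /x => ->; rewrite subr0 (unorm1 hnrm) ltxx.
have [N hN] := expr_lt_eps x01 al1.
have [N' hN'] := hl _ (divr_gt0 al1 a_gt0).
have := ltxx (nrm (a * l - 1)).
suff -> : nrm (a * l - 1) < nrm (a * l - 1) by [].
pose k := maxn N N'.
have {1}-> : a * l - 1 = - (a * (u k - l)) - x ^+ k.
  by rewrite mulrBr a_u !opprB -addrA; congr (_ + _);
    rewrite addrAC subrr add0r.
apply: le_lt_trans (unormD hnrm _ _) _; rewrite !(unormN hnrm) gt_max.
rewrite (le_lt_trans (unormX hnrm _ _)) ?hN ?leq_maxl// andbT.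
apply: le_lt_trans (unormM hnrm _ _) _.
by rewrite mulrC -ltr_pdivlMr// hN' ?leq_maxr.
Qed.

Lemma opnorm_bound (d : {additive B -> B}) b :
  continuous_derivation nrm d -> nrm (d b) <= opnorm nrm d * nrm b.
Proof.
case=> _ _ hub; have [->|b0] := eqVneq b 0.
  by rewrite raddf0 (unorm0 hnrm) mulr0.
rewrite -ler_pdivrMr ?ubanach_gt0//.
by apply: ub_le_sup => //; exists b.
Qed.

End UltrametricBanach.

(** * Divided powers of [t] and the exponential of the nilpotent shift *)

Section DividedPower.
Context {B : comUnitRingType}.
Implicit Types (x y t : B).

Definition divpow t k : B := t ^+ k / k`!%:R.

Lemma fact_unit_le j m :
  (j <= m)%N -> (m`!%:R : B) \is a GRing.unit -> (j`!%:R : B) \is a GRing.unit.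
Proof.
move=> jm; rewrite -(ffact_fact (leq_subr j m)) subKn// natrM unitrM.
by case/andP.
Qed.

Lemma divpowD x y m : (m`!%:R : B) \is a GRing.unit ->
  divpow (x + y) m = \sum_(k < m.+1) divpow x k * divpow y (m - k).
Proof.
move=> um; rewrite /divpow addrC exprDn big_distrl; apply: eq_bigr => k _ /=.
have km : (k <= m)%N by rewrite -ltnS.
have uk := fact_unit_le km um; have umk := fact_unit_le (leq_subr k m) um.
rewrite [RHS]mulrACA [y ^+ _ * _]mulrC -[_ *+ 'C(m, k)]mulr_natr.
rewrite -[LHS]mulrA; congr (_ * _).
apply: (mulIr um); rewrite mulrVK// -(bin_fact km) natrM natrM.
by rewrite mulrCA mulrACA !mulVr// !mulr1.
Qed.

Lemma divpow_0 k : divpow 0 k = (k == 0%N)%:R.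
Proof.
by case: k => [|k]; rewrite /divpow ?expr0 ?invr1 ?mulr1// expr0n mul0r.
Qed.

(** The test is needed because truncated subtraction would put 1 below the diagonal. Natural indices
    allow rows beyond the matrix, reached when [nabla] is iterated. *)
Definition divpow_shift t i j : B := if (i <= j)%N then divpow t (j - i) else 0.

Definition divpow_mx n t : 'M[B]_n := \matrix_(i, j) divpow_shift t i j.

(** The exponential law for commuting multiples of the shift: each entry is the divided binomial
    formula of degree [j - i <= n - 1]. *)
Lemma divpow_mxD n x y : ((n.-1)`!%:R : B) \is a GRing.unit ->
  divpow_mx n x *m divpow_mx n y = divpow_mx n (x + y).
Proof.
move=> un; apply/matrixP => i j; rewrite !mxE.
under eq_bigr do rewrite !mxE.
rewrite -(big_mkord xpredT (fun k => divpow_shift x i k * divpow_shift y k j)).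
rewrite {3}/divpow_shift; case: leqP => [ij|ji]; last first.
  rewrite big1// => k _; rewrite /divpow_shift.
  case: (leqP i k) => ik; last by rewrite mul0r.
  by rewrite leqNgt (leq_trans ji ik) mulr0.
(* Only the indices [i <= k <= j] contribute; the two outer ranges are cut off, then [k] is shifted
   by [i]. *)
rewrite (big_cat_nat (n := i)) ?(ltnW (ltn_ord i))//=.
rewrite big_nat_cond big1 ?add0r; last first.
  by move=> k /andP[/andP[_ ki] _]; rewrite {1}/divpow_shift leqNgt ki mul0r.
rewrite (big_cat_nat (n := j.+1)) ?(leq_trans ij)//=.
rewrite [X in _ + X]big_nat_cond [X in _ + X]big1 ?addr0; last first.
  by move=> k /andP[/andP[jk _] _]; rewrite {2}/divpow_shift leqNgt jk mulr0.
have un' : ((j - i)`!%:R : B) \is a GRing.unit.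
  apply: fact_unit_le un; apply: leq_trans (leq_subr _ _) _.
  by rewrite -ltnS prednK// (leq_ltn_trans _ (ltn_ord j)).
rewrite divpowD// -{1}[nat_of_ord i]add0n big_addn subSn// big_mkord.
apply: eq_bigr => k _; rewrite /divpow_shift leq_addl addnK.
have -> : (k + i <= j)%N by rewrite addnC -leq_subRL// -ltnS.
by rewrite addnC subnDA.
Qed.

Lemma divpow_mx0 n : divpow_mx n 0 = 1%:M.
Proof.
apply/matrixP => i j; rewrite !mxE /divpow_shift divpow_0 -(inj_eq val_inj)/=.
by rewrite subn_eq0 [in RHS]eqn_leq; case: leqP.
Qed.

Lemma derivation_divpow (d : {additive B -> B}) t k :
  derivation d -> d t = 1 -> (k.+1`!%:R : B) \is a GRing.unit ->
  d (divpow t k.+1) = divpow t k.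
Proof.
move=> hd dt uk.
have dX m : d (t ^+ m.+1) = t ^+ m *+ m.+1.
  elim: m => [|m IH]; first by rewrite expr1 dt.
  by rewrite exprS hd dt IH mul1r mulrnAr -exprS [RHS]mulrSr.
have uk' := fact_unit_le (leqnSn k) uk.
have dk : divpow t k.+1 *+ k.+1`! = t ^+ k.+1.
  by rewrite -[LHS]mulr_natr mulrVK.
apply: (mulrI uk); rewrite [LHS]mulr_natl -raddfMn /= dk dX.
by rewrite factS natrM -mulrA [k`!%:R * _]mulrC mulrVK// [RHS]mulr_natl.
Qed.

Lemma derivation1 (d : {additive B -> B}) : derivation d -> d 1 = 0.
Proof.
move=> hd; apply: (@addrI _ (d 1)); rewrite addr0.
by rewrite -{3}[X in d X]mul1r hd mul1r mulr1.
Qed.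

(** Deriving the exponential multiplies it by the shift, moving row [i] to row [i.+1]. On the
    diagonal this is [d 1 = 0]. *)
Lemma derivation_divpow_shift (d : {additive B -> B}) t i j :
  derivation d -> d t = 1 -> (j`!%:R : B) \is a GRing.unit ->
  d (divpow_shift t i j) = divpow_shift t i.+1 j.
Proof.
move=> hd dt uj; rewrite /divpow_shift.
case: (ltngtP i j) => [ij|_|->]; last 2 first.
- by rewrite raddf0.
- by rewrite subnn /divpow expr0 invr1 mulr1 derivation1.
rewrite -subSS subSn// derivation_divpow//.
by apply: fact_unit_le uj; rewrite -subSn// subSS leq_subr.
Qed.

End DividedPower.

(** * The weighted sup norm on [M] and change of basis *)

Section WeightedBound.
Context {R : realType} {B : comUnitRingType} {nrm : B -> R} {M : lmodType B}.
Context {n : nat} {e : 'I_n -> M} {D : R}.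
Hypothesis hnrm : ultrametric_norm nrm.
Hypothesis D_ge0 : 0 <= D.

(* The sup norm on [M] in which [e j] has norm [D ^+ j]; operators bounded by
   [rho_norm nrm D] in the basis [e] are then bounded in the usual sense. *)
Definition weighted_le (x : R) (m : M) : Prop :=
  exists2 c : 'rV[B]_n, m = \sum_j c 0 j *: e j &
    forall j, nrm (c 0 j) * D ^+ j <= x.

Lemma weighted_leW x y m : x <= y -> weighted_le x m -> weighted_le y m.
Proof. by move=> xy [c -> hc]; exists c => // j; apply: le_trans xy. Qed.

Lemma weighted_le0 x : 0 <= x -> weighted_le x 0.
Proof.
move=> x0; exists 0; last by move=> j; rewrite mxE (unorm0 hnrm) mul0r.
by rewrite big1// => j _; rewrite mxE scale0r.
Qed.

Lemma weighted_leD x m m' :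
  weighted_le x m -> weighted_le x m' -> weighted_le x (m + m').
Proof.
move=> [c -> hc] [c' -> hc']; exists (c + c').
  by rewrite -big_split; apply: eq_bigr => j _; rewrite mxE scalerDl.
move=> j; rewrite mxE.
apply: le_trans (ler_wpM2r (exprn_ge0 _ D_ge0) (unormD hnrm _ _)) _.
by rewrite maxr_pMl ?exprn_ge0// ge_max hc hc'.
Qed.

Lemma weighted_le_sum (I : Type) (r : seq I) (P : pred I) (F : I -> M) x :
  0 <= x -> (forall i, P i -> weighted_le x (F i)) ->
  weighted_le x (\sum_(i <- r | P i) F i).
Proof.
move=> x0 hF; apply: (big_ind (weighted_le x)) => //; first exact: weighted_le0.
by move=> m m'; apply: weighted_leD.
Qed.

Lemma weighted_leZ x b m : weighted_le x m -> weighted_le (nrm b * x) (b *: m).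
Proof.
move=> [c -> hc]; exists (b *: c).
  by rewrite scaler_sumr; apply: eq_bigr => j _; rewrite mxE scalerA.
move=> j; rewrite mxE.
apply: le_trans (ler_wpM2r (exprn_ge0 _ D_ge0) (unormM hnrm _ _)) _.
by rewrite -mulrA ler_wpM2l// (unorm_ge0 hnrm).
Qed.

Lemma weighted_leZ1 x b m :
  0 <= x -> nrm b <= 1 -> weighted_le x m -> weighted_le x (b *: m).
Proof.
move=> x0 b1 /(weighted_leZ b); apply: weighted_leW.
by rewrite ler_piMl.
Qed.

Lemma weighted_le_basis (j : 'I_n) : weighted_le (D ^+ j) (e j).
Proof.
exists (delta_mx 0 j).
  rewrite (bigD1 j)//= mxE !eqxx scale1r big1 ?addr0// => i /negPf ij.
  by rewrite mxE ij andbF scale0r.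
move=> i; rewrite mxE eqxx /=; have [->|_] := eqVneq.
  by rewrite (unorm1 hnrm) mul1r.
by rewrite (unorm0 hnrm) mul0r exprn_ge0.
Qed.

End WeightedBound.
Arguments weighted_le {R B} nrm {M n} e D x m.

Lemma rho_norm_entry (R : realType) (B : comUnitRingType) (nrm : B -> R)
    (rho : R) n (A : 'M[B]_n) i j :
  0 < rho -> nrm (A i j) * rho ^+ j <= rho_norm nrm rho A * rho ^+ i.
Proof.
move=> rho0; rewrite -ler_pdivrMr ?exprn_gt0//.
apply: le_trans (le_bigmax _ _ i); apply: le_trans (le_bigmax _ _ j).
by rewrite expfzDr ?lt0r_neq0// exprnN -!exprnP mulrA.
Qed.

Lemma rho_norm_ge0 (R : realType) (B : comUnitRingType) (nrm : B -> R)
    (rho : R) n (A : 'M[B]_n) : 0 <= rho_norm nrm rho A.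
Proof.
by rewrite /rho_norm; elim/big_rec: _ => // i x _ x0; rewrite le_max x0 orbT.
Qed.

(** Coordinate rows on [f] become coordinate rows on [e] by right multiplication by [P], which is
    bijective. *)
Lemma is_basis_unitmx (B : comUnitRingType) (M : lmodType B) n
    (e f : 'I_n -> M) (P : 'M[B]_n) :
  is_basis e -> P \in unitmx ->
  (forall i, f i = \sum_j P i j *: e j) -> is_basis f.
Proof.
move=> he uP hf m.
have comb (c : 'rV_n) : \sum_i c 0 i *: f i = \sum_j (c *m P) 0 j *: e j.
  under eq_bigr do rewrite hf scaler_sumr.
  rewrite exchange_big; apply: eq_bigr => j _ /=.
  by rewrite mxE scaler_suml; apply: eq_bigr => i _; rewrite scalerA.
have [a [-> a_uniq]] := he m.
exists (a *m invmx P); split; first by rewrite comb mulmxKV.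
by move=> c; rewrite comb => /a_uniq ->; rewrite mulmxK.
Qed.

(** * Iterates of the Katz vector under a small connection *)

Section SmallConnection.
Context {R : realType} {B : comUnitRingType} {nrm : B -> R} {M : lmodType B}.
Context {d : {additive B -> B}} {nabla : {additive M -> M}}.
Context {n : nat} {e : 'I_n -> M} {G : 'M[B]_n} {D : R}.
Hypothesis hnrm : ultrametric_norm nrm.
Hypothesis D_gt0 : 0 < D.
Hypothesis hd : forall b, nrm (d b) <= D * nrm b.
Hypothesis nablaZ : forall (b : B) m, nabla (b *: m) = d b *: m + b *: nabla m.
Hypothesis hG : connection_matrix nabla e G.
Let gamma := rho_norm nrm D G.
Hypothesis gammaD : gamma <= D.
Let D_ge0 : 0 <= D := ltW D_gt0.
Local Notation bounded := (weighted_le nrm e D).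

(** All smallness comes from here: on basis vectors [nabla] costs [gamma], against [D] on general
    vectors. *)
Lemma bounded_nabla_basis (j : 'I_n) : bounded (gamma * D ^+ j) (nabla (e j)).
Proof.
exists (row j G); first by rewrite hG; apply: eq_bigr => k _; rewrite mxE.
by move=> k; rewrite mxE rho_norm_entry.
Qed.

(** By the Leibniz rule, differentiating coefficients costs [D] and differentiating basis vectors
    costs [gamma <= D]. *)
Lemma bounded_nabla x m : 0 <= x -> bounded x m -> bounded (D * x) (nabla m).
Proof.
move=> x0 [c -> hc].
rewrite raddf_sum; apply: weighted_le_sum => // [|j _].
  by rewrite mulr_ge0.
rewrite nablaZ; apply: weighted_leD => //.
- apply: weighted_leW
    (weighted_leZ hnrm D_ge0 _ (weighted_le_basis hnrm D_ge0 j)).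
  apply: le_trans (ler_wpM2r (exprn_ge0 _ D_ge0) (hd _)) _.
  by rewrite -mulrA ler_wpM2l.
- apply: weighted_leW (weighted_leZ hnrm D_ge0 _ (bounded_nabla_basis j)).
  rewrite mulrCA; apply: le_trans (_ : D * (nrm (c 0 j) * D ^+ j) <= _).
    by rewrite ler_wpM2r ?mulr_ge0 ?exprn_ge0 ?(unorm_ge0 hnrm).
  by rewrite ler_wpM2l.
Qed.

Lemma bounded_iter_nabla x m k :
  0 <= x -> bounded x m -> bounded (D ^+ k * x) (iter k nabla m).
Proof.
move=> x0 hm; elim: k => [|k IH] /=; first by rewrite expr0 mul1r.
rewrite exprS -mulrA; apply: bounded_nabla => //.
by rewrite mulr_ge0 ?exprn_ge0.
Qed.

Context {t : B}.
Hypothesis d_deriv : derivation d.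
Hypothesis dt : d t = 1.
Hypothesis hfact : ((n.-1)`!%:R : B) \is a GRing.unit.
Let F := nrm (n.-1)`!%:R.
Let tau := D * nrm t.
Hypothesis tau_ge1 : 1 <= tau.

Let F_gt0 : 0 < F. Proof. exact: unorm_unit_nat_gt0. Qed.
Let tauF_ge0 : 0 <= tau ^+ n.-1 / F.
Proof. by rewrite divr_ge0 ?(ltW F_gt0) ?exprn_ge0 ?(le_trans ler01). Qed.
Let t_ge0 : 0 <= nrm t. Proof. exact: unorm_ge0. Qed.
Let gamma_ge0 : 0 <= gamma. Proof. exact: rho_norm_ge0. Qed.
Let le_pred (j : 'I_n) : (j <= n.-1)%N.
Proof. by rewrite -ltnS prednK// (leq_ltn_trans _ (ltn_ord j)). Qed.

Lemma unorm_divpow u j : (j <= n.-1)%N -> nrm (divpow u j) <= nrm u ^+ j / F.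
Proof.
move=> jn; have uj := fact_unit_le jn hfact.
rewrite unorm_div_nat// ler_pM ?invr_ge0 ?(unorm_ge0 hnrm) ?unormX//.
by rewrite lef_pV2 ?posrE ?unorm_unit_nat_gt0// unorm_fact_le.
Qed.

(** Since [tau >= 1], the power [tau ^+ (j - i)] is at most [tau ^+ n.-1]. A general [u] serves both
    [t] and [- t], that is, the exponential and its inverse. *)
Lemma unorm_divpow_shift u i (j : 'I_n) : nrm u = nrm t ->
  nrm (divpow_shift u i j) * D ^+ j <= D ^+ i * (tau ^+ n.-1 / F).
Proof.
move=> ut; rewrite /divpow_shift; case: leqP => [ij|_]; last first.
  by rewrite (unorm0 hnrm) mul0r mulr_ge0 ?exprn_ge0.
rewrite -{2}(subnKC ij) exprD [leLHS]mulrCA ler_wpM2l ?exprn_ge0//.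
have ijn : (j - i <= n.-1)%N := leq_trans (leq_subr _ _) (le_pred j).
apply: le_trans (ler_wpM2r (exprn_ge0 _ D_ge0) (unorm_divpow u ijn)) _.
rewrite mulrAC ler_wpM2r ?invr_ge0 ?(ltW F_gt0)// ut mulrC -exprMn.
exact: ler_weXn2l.
Qed.

Definition divpow_sum i : M := \sum_(j < n) divpow_shift t i j *: e j.

Let delta := gamma / D * (tau ^+ n.-1 / F).
Let delta_ge0 : 0 <= delta.
Proof. by rewrite mulr_ge0// divr_ge0. Qed.

Lemma nabla_divpow_sum i :
  nabla (divpow_sum i) =
    divpow_sum i.+1 + \sum_(j < n) divpow_shift t i j *: nabla (e j).
Proof.
rewrite raddf_sum -big_split; apply: eq_bigr => j _ /=.
by rewrite nablaZ derivation_divpow_shift//; apply: fact_unit_le hfact.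
Qed.

(** The [k = 0] terms of the Katz vector are exactly [divpow_sum 0]; every other term applies
    [nabla] to a basis vector and so carries a factor [gamma]. *)
Lemma bounded_katz0 : bounded delta (katz_vector nabla e t - divpow_sum 0).
Proof.
rewrite -sumrB; apply: weighted_le_sum => // j _.
rewrite /divpow_shift leq0n subn0 -/(divpow t j) -scalerBr.
rewrite big_ord_recl /= expr0 bin0 mulr1 scale1r.
have -> : ord_subn j 0 = j by apply: val_inj; rewrite /= subn0.
rewrite addrC addKr scaler_sumr; apply: weighted_le_sum => // k _.
rewrite /bump leq0n add1n.
set l := ord_subn j _.
have hj : (k.+1 + l)%N = j by rewrite subnKC.
have y0 : 0 <= gamma * D ^+ l by rewrite mulr_ge0 ?exprn_ge0.
have x0 : 0 <= D ^+ k * (gamma * D ^+ l) by rewrite mulr_ge0 ?exprn_ge0.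
have b1 : nrm ((-1) ^+ k.+1 * 'C(j, k.+1)%:R) <= 1.
  by rewrite -signr_odd unorm_sign_mul ?unorm_nat_le1.
(* The innermost [nabla] meets [e l] and costs [gamma]; the [k] others cost [D] each. With
   [k.+1 + l = j] the powers of [D] complete [tau ^+ j], up to one factor [D]. *)
rewrite -iterS iterSr; apply: weighted_leW (weighted_leZ hnrm D_ge0 _
  (weighted_leZ1 hnrm D_ge0 x0 b1
    (bounded_iter_nabla k y0 (bounded_nabla_basis l)))).
apply: le_trans (ler_wpM2r x0 (unorm_divpow t (le_pred j))) _.
have -> : nrm t ^+ j / F * (D ^+ k * (gamma * D ^+ l)) =
    gamma / D * (tau ^+ j / F).
  have -> : tau ^+ j = nrm t ^+ j * (D * D ^+ k * D ^+ l).
    by rewrite exprMn -[in D ^+ j]hj exprD exprS mulrC.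
  by field; rewrite !lt0r_neq0.
rewrite ler_wpM2l ?divr_ge0// ler_wpM2r ?invr_ge0 ?(ltW F_gt0)//.
exact: ler_weXn2l.
Qed.

(** The new error is [nabla] of the old one plus the part of [nabla (divpow_sum i)] where basis
    vectors are differentiated; both are at most [D ^+ i.+1 * delta]. *)
Lemma bounded_katz i :
  bounded (D ^+ i * delta)
    (iter i nabla (katz_vector nabla e t) - divpow_sum i).
Proof.
elim: i => [|i IH]; first by rewrite expr0 mul1r; exact: bounded_katz0.
have -> : iter i.+1 nabla (katz_vector nabla e t) - divpow_sum i.+1 =
    nabla (iter i nabla (katz_vector nabla e t) - divpow_sum i) +
    \sum_(j < n) divpow_shift t i j *: nabla (e j).
  by rewrite raddfB /= nabla_divpow_sum opprD addrA subrK.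
apply: weighted_leD => //.
  rewrite exprS -mulrA; apply: bounded_nabla => //.
  by rewrite mulr_ge0 ?exprn_ge0.
apply: weighted_le_sum => // [|j _]; first by rewrite mulr_ge0 ?exprn_ge0.
apply: weighted_leW (weighted_leZ hnrm D_ge0 _ (bounded_nabla_basis j)).
rewrite mulrCA exprS /delta.
have -> : D * D ^+ i * (gamma / D * (tau ^+ n.-1 / F)) =
    gamma * (D ^+ i * (tau ^+ n.-1 / F)).
  by rewrite mulrACA [D * _]mulrC mulfVK ?lt0r_neq0.
by rewrite ler_wpM2l ?unorm_divpow_shift.
Qed.

Hypothesis hB : ultrametric_banach nrm.
Hypothesis he : is_basis e.
Hypothesis hsmall : delta * (tau ^+ n.-1 / F) < 1.

Lemma katz_vector_cyclic : cyclic_vector n nabla (katz_vector nabla e t).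
Proof.
have [err err_def err_le] := fin_all_exists2 (fun i : 'I_n => bounded_katz i).
pose E : 'M[B]_n := \matrix_(i, j) err i 0 j.
pose A := 1%:M + divpow_mx n (- t) *m E.
have uT : divpow_mx n t \in unitmx.
  have : divpow_mx n t *m divpow_mx n (- t) = 1%:M.
    by rewrite divpow_mxD// subrr divpow_mx0.
  by case/mulmx1_unit.
have uA : A \in unitmx.
  rewrite unitmxE; apply: (ubanach_unit hB).
  apply: (unorm_det_sub1 hnrm (w := fun i => D ^+ i)) => [i|i j].
    by rewrite exprn_gt0.
  rewrite /A addrC addKr.
  rewrite mxE -ltr_pdivlMr ?exprn_gt0//.
  apply: (unorm_sum_lt hnrm) => [|k _]; first by rewrite divr_gt0 ?exprn_gt0.
  rewrite ltr_pdivlMr ?exprn_gt0// !mxE.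
  (* The inverse exponential contributes [tau ^+ n.-1 / F] and the error row [delta]; the
     intermediate weight [D ^+ k] passes from one to the other. *)
  apply: le_lt_trans (_ : D ^+ i * (delta * (tau ^+ n.-1 / F)) < _); last first.
    by rewrite gtr_pMr ?exprn_gt0.
  apply: le_trans (ler_wpM2r (exprn_ge0 _ D_ge0) (unormM hnrm _ _)) _.
  rewrite -mulrA; apply: le_trans (ler_wpM2l (unorm_ge0 hnrm _) (err_le k j)) _.
  rewrite [leLHS]mulrA [leRHS]mulrCA [leLHS]mulrC ler_wpM2l//.
  by rewrite unorm_divpow_shift// unormN.
apply: (is_basis_unitmx he (P := divpow_mx n t *m A)) => [|i].
  by rewrite unitmx_mul uT.
rewrite -[LHS](subrK (divpow_sum i)) err_def -big_split.
apply: eq_bigr => j _ /=; rewrite mulmxDr mulmx1 mulmxA divpow_mxD//.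
rewrite subrr divpow_mx0 mul1mx !mxE.
by rewrite addrC scalerDl.
Qed.

End SmallConnection.

(** * Reduction of the stated bound to the small connection case *)

Theorem proposition2p8 (R : realType) (B : comUnitRingType) (nrm : B -> R)
  (d : {additive B -> B}) (M : lmodType B) (nabla : {additive M -> M})
  (n : nat) (e : 'I_n -> M) (t : B) (G1 : 'M[B]_n)
  (hn : (0 < n)%N)
  (hB : ultrametric_banach nrm)
  (hd : continuous_derivation nrm d)
  (hM : differential_module n d nabla)
  (he : is_basis e)
  (hfact : (n.-1)`!%:R \is a @GRing.unit B)
  (ht : d t = 1)
  (hG1 : connection_matrix nabla e G1)
  (hsmall : rho_norm nrm (opnorm nrm d) G1 <
     nrm (n.-1)`!%:R ^+ 2 * opnorm nrm d
       / (opnorm nrm d * nrm t) ^+ (2 * n - 2)) :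
  is_cyclic n nabla /\ cyclic_vector n nabla (katz_vector nabla e t).
Proof.
have hnrm := ubanach_norm hB.
have d_le b := opnorm_bound hB b hd.
set D := opnorm nrm d in hsmall d_le.
set F := nrm (n.-1)`!%:R in hsmall; set tau := D * nrm t in hsmall.
(* [1 = |d t| <= |d| |t|]; this also forces [|d| > 0]. *)
have tau_ge1 : 1 <= tau by have := d_le t; rewrite ht (unorm1 hnrm).
have D_gt0 : 0 < D.
  rewrite ltNge; apply/negP => D_le0; have := lt_le_trans ltr01 tau_ge1.
  by rewrite ltNge /tau mulr_le0_ge0 ?(unorm_ge0 hnrm).
have F_gt0 : 0 < F by exact: unorm_unit_nat_gt0.
have F_le1 : F <= 1 by exact: unorm_nat_le1.
have tau_gt0 : 0 < tau := lt_le_trans ltr01 tau_ge1.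
(* The exponent [2n - 2] and the square of [F] split into two equal factors: one from the error
   estimate, one from inverting the exponential. *)
have small : rho_norm nrm D G1 / D * (tau ^+ n.-1 / F) * (tau ^+ n.-1 / F) < 1.
  have -> : rho_norm nrm D G1 / D * (tau ^+ n.-1 / F) * (tau ^+ n.-1 / F) =
      rho_norm nrm D G1 / (F ^+ 2 * D / tau ^+ (2 * n - 2)).
    have -> : (2 * n - 2 = n.-1 + n.-1)%N.
      by case: (n) hn => // m _; rewrite mul2n -addnn addSn addnS !subSS subn0.
    by rewrite exprD; field; rewrite !lt0r_neq0 ?exprn_gt0.
  by rewrite ltr_pdivrMr ?mul1r// divr_gt0 ?mulr_gt0 ?exprn_gt0.
(* The bound in [hsmall] is [D] times [F ^+ 2 / tau ^+ (2 * n - 2)], which is at most 1 as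
   [F <= 1 <= tau]. *)
have gammaD : rho_norm nrm D G1 <= D.
  apply: ltW (lt_le_trans hsmall _).
  rewrite -mulrA [D / _]mulrC mulrA ler_piMl ?(ltW D_gt0)//.
  rewrite mulr_ile1 ?invr_ge0 ?exprn_ge0 ?exprn_ile1 ?(ltW tau_gt0)
     ?(ltW F_gt0)//.
  by rewrite invf_le1 ?exprn_gt0// exprn_ege1.
have [d_deriv _ _] := hd; have [_ nablaZ] := hM.
have katz : cyclic_vector n nabla (katz_vector nabla e t).
  exact: (katz_vector_cyclic hnrm D_gt0 d_le nablaZ hG1 gammaD d_deriv ht hfact
    tau_ge1 hB he small).
by split => //; exists (katz_vector nabla e t).
Qed.
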